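(* Let $K(\mathbf{x})$ be a closed convex function on $\mathbb{R}^{n_x}$, and let $K(\mathbf{x})+\|M\mathbf{x}\|^2$ be strictly convex. Let $\boldsymbol{\mu}^0\in\mathbb{R}^{n_s}$ and $\mathbf{x}^0\in\mathbb{R}^{n_x}$ be arbitrary and let $\lambda>0$. Suppose that (i) $\displaystyle \left\| \mathbf{x}^{k+1} - \operatorname*{argmin}_{\mathbf{x}} \left( K(\mathbf{x})- \langle\boldsymbol{\mu}^k,\, M\mathbf{x}\rangle + \frac{\lambda}{2}\| M\mathbf{x}-\mathbf{s}\|^2 \right) \right\| < \nu_k$, (ii) $\boldsymbol{\mu}^{k+1} = \boldsymbol{\mu}^k + \lambda\left(\mathbf{s} - M\mathbf{x}^{k+1}\right)$, where $\nu_k\geq 0$ and $\sum_{k=0}^{\infty}\nu_k < +\infty$. If there exists a saddle point $(\hat{\mathbf{x}},\hat{\boldsymbol{\mu}})$ of the Lagrangian function $$\mathcal{L}(\mathbf{x},\boldsymbol{\mu}) = K(\mathbf{x}) - \langle \boldsymbol{\mu},\, M\mathbf{x} - \mathbf{s}\rangle,$$ then $\mathbf{x}^k\to\hat{\mathbf{x}}$ and $\boldsymbol{\mu}^k\to\hat{\boldsymbol{\mu}}$. If no such saddle point exists, then at least one of the sequences $\{\mathbf{x}^k\}$ and $\{\boldsymbol{\mu}^k\}$ is unbounded.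
   Context: Norms are Euclidean and $\langle\cdot,\cdot\rangle$ is the Euclidean scalar product. Here $M\in\mathbb{R}^{n_s\times n_x}$ and $\mathbf{s}\in\mathbb{R}^{n_s}$ are the data of the linearly constrained problem $\min K(\mathbf{x})$ subject to $M\mathbf{x}=\mathbf{s}$, and (i)-(ii), required for all $k\ge 0$, describe an augmented Lagrangian (Bregman) iteration for this problem with inexact inner minimization. In the paper the problem arises with $\mathbf{x}=[\mathbf{u};\mathbf{d}]$, $\mathbf{u}\in\mathbb{R}^n$, $\mathbf{d}\in\mathbb{R}^q$, $n_x=n+q$, $n_s=m+q$, $K(\mathbf{x})=f(\mathbf{u})+\tau_1\|\mathbf{u}\|_1+\tau_2\|\mathbf{d}\|_1$ with $f:\mathbb{R}^n\to\mathbb{R}$ closed, convex and at least twice continuously differentiable, $M=\begin{bmatrix}A&0\\ D&-I\end{bmatrix}$ with $A\in\mathbb{R}^{m\times n}$, $D\in\mathbb{R}^{q\times n}$, and $\mathbf{s}=[\mathbf{b};\mathbf{0}]$ with $\mathbf{b}\in\mathbb{R}^m$. A pair $(\hat{\mathbf{x}},\hat{\boldsymbol{\mu}})$ is a saddle point of $\mathcal{L}$ when $M^\top\hat{\boldsymbol{\mu}}\in\partial K(\hat{\mathbf{x}})$ and $M\hat{\mathbf{x}}=\mathbf{s}$, where $\partial K$ is the convex subdifferential.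
   Formalization: Multipliers need not be unique (M=0, s=0, K=|x|^2 gives μ^k=μ^0 for all k), so instead of μ^k→μ̂ for the given μ̂, it is proved that μ^k converges to some μ* such that (x̂,μ* ) is a saddle point; x^k→x̂ is kept. *)

(* Defs.v *)
From HB Require Import structures.
From mathcomp Require Import all_boot all_order all_algebra.
From mathcomp Require Import all_classical all_reals all_analysis.

Set Implicit Arguments.
Unset Strict Implicit.
Unset Printing Implicit Defensive.

Import Order.TTheory GRing.Theory Num.Theory.
Import numFieldNormedType.Exports.

Local Open Scope classical_set_scope.
Local Open Scope ring_scope.

(* The library norm `|x| on matrices is the sup norm, hence the explicit
   Euclidean structure; both norms induce the library topology of 'cV[R]_n. *)
Definition dot (R : realType) (n : nat) (u v : 'cV[R]_n) : R :=
  \sum_(i < n) u i ord0 * v i ord0.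

Definition enorm (R : realType) (n : nat) (u : 'cV[R]_n) : R :=
  Num.sqrt (dot u u).

Definition bounded_seq (R : realType) (n : nat) (u : nat -> 'cV[R]_n) : Prop :=
  exists B : R, forall k, enorm (u k) <= B.

(* Convex functions are extended-valued, as is usual when one speaks of closed
   convex functions; a finite function f is the case x |-> (f x)%:E. *)
Definition proper_fun (R : realType) (n : nat) (F : 'cV[R]_n -> \bar R) : Prop :=
  (forall x, (-oo < F x)%E) /\ (exists x, (F x < +oo)%E).

(* For functions that never take the value -oo this is convexity of the
   epigraph: no sum of opposite infinities occurs. *)
Definition convex_efun (R : realType) (n : nat) (F : 'cV[R]_n -> \bar R) : Prop :=
  forall (x y : 'cV[R]_n) (t : R), 0 < t -> t < 1 ->
    (F ((t *: x + (1 - t) *: y)%R) <= t%:E * F x + (1 - t)%:E * F y)%E.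

(* Strictness can only be required between points of the effective domain. *)
Definition strictly_convex_efun (R : realType) (n : nat)
    (F : 'cV[R]_n -> \bar R) : Prop :=
  convex_efun F /\
  forall (x y : 'cV[R]_n) (t : R), 0 < t -> t < 1 -> x != y ->
    (F x < +oo)%E -> (F y < +oo)%E ->
    (F ((t *: x + (1 - t) *: y)%R) < t%:E * F x + (1 - t)%:E * F y)%E.

(* For a proper convex function, closed means lower semicontinuous. *)
Definition closed_convex (R : realType) (n : nat) (F : 'cV[R]_n -> \bar R) : Prop :=
  [/\ proper_fun F, convex_efun F & lower_semicontinuous F].

Definition subdifferential (R : realType) (n : nat) (F : 'cV[R]_n -> \bar R)
    (x : 'cV[R]_n) : set 'cV[R]_n :=
  [set g | forall y, (F x + (dot g (y - x))%:E <= F y)%E].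

Definition argmin (R : realType) (n : nat) (F : 'cV[R]_n -> \bar R) :
    set 'cV[R]_n :=
  [set z | forall y, (F z <= F y)%E].

Definition augmented_lagrangian (R : realType) (nx ns : nat)
    (K : 'cV[R]_nx -> \bar R) (M : 'M[R]_(ns, nx)) (s : 'cV[R]_ns)
    (lambda : R) (mu : 'cV[R]_ns) (x : 'cV[R]_nx) : \bar R :=
  (K x - (dot mu (M *m x))%:E
   + (lambda / 2 * enorm ((M *m x - s)%R) ^+ 2)%:E)%E.

(* Saddle points of L(x, mu) = K x - <mu, M x - s>, via optimality
   conditions. *)
Definition saddle_point (R : realType) (nx ns : nat)
    (K : 'cV[R]_nx -> \bar R) (M : 'M[R]_(ns, nx)) (s : 'cV[R]_ns)
    (x : 'cV[R]_nx) (mu : 'cV[R]_ns) : Prop :=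
  subdifferential K x (M^T *m mu) /\ M *m x = s.

(* Main.v *)
Require Import Defs.
From HB Require Import structures.
From mathcomp Require Import all_boot all_order all_algebra.
From mathcomp Require Import all_classical all_reals all_analysis.
From mathcomp Require Import ring lra.
Import Order.TTheory GRing.Theory Num.Theory.
Import numFieldNormedType.Exports.
Local Open Scope classical_set_scope.
Local Open Scope ring_scope.

(** The multiplier update with an exact inner minimizer [z k] is a proximal step
    on the dual problem. Optimality of [z k] says that
    [M^T *m exact_multiplier k] is a subgradient of [K] at [z k]
    ([argmin_augmented_lagrangian]), where
    [exact_multiplier k = mu k - lambda *: residual k] and
    [residual k = M *m z k - s]. The true multiplier [mu k.+1] differs from
    [exact_multiplier k] by at most a summable error, so everything reduces to
    two facts: the residuals tend to zero, and then limits of the pairs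
    [(z k, exact_multiplier k)] are saddle points, because the graph of the
    subdifferential of a closed function is closed ([limit_saddle_point]).

    If a saddle point exists, monotonicity of the subdifferential shows that the
    exact step reduces the squared distance to an optimal multiplier by at least
    [lambda ^+ 2] times the squared residual ([exact_multiplier_fejer]). The
    distances therefore converge, the residuals vanish
    ([residual_cvg0_saddle]), and the values of [K] at the [z k] are
    asymptotically at most the constrained minimum. Strict convexity makes the
    constrained minimizer unique ([saddle_point_unique]) and convexity keeps the
    [z k] from escaping to infinity, so they converge to it
    ([exact_minimizer_cvg]), and so do the [x k]. The multipliers are bounded;
    one of their limit points is an optimal multiplier, to which their distance
    converges, hence they converge to it ([multiplier_cvg]).

    Conversely, if both sequences are bounded, the dual objective is bounded
    along the iteration and increases at each step by [lambda] times the squared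
    residual up to a summable error ([residual_cvg0_bounded]). The residuals
    again vanish and any limit pair is a saddle point
    ([bounded_saddle_point]). *)

(** * Euclidean geometry of column vectors *)

Section Euclidean.
Context {R : realType} {n : nat}.
Implicit Types (u v w : 'cV[R]_n) (a : R).

Lemma dotC u v : dot u v = dot v u.
Proof. by apply: eq_bigr => i _; rewrite mulrC. Qed.

Lemma dotDl u v w : dot (u + v) w = dot u w + dot v w.
Proof. by rewrite -big_split; apply: eq_bigr => i _; rewrite mxE mulrDl. Qed.

Lemma dotZl a u w : dot (a *: u) w = a * dot u w.
Proof. by rewrite mulr_sumr; apply: eq_bigr => i _; rewrite mxE mulrA. Qed.

Lemma dotNl u w : dot (- u) w = - dot u w.
Proof. by rewrite -scaleN1r dotZl mulN1r. Qed.

Lemma dotDr u v w : dot w (u + v) = dot w u + dot w v.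
Proof. by rewrite !(dotC w) dotDl. Qed.

Lemma dotZr a u w : dot w (a *: u) = a * dot w u.
Proof. by rewrite !(dotC w) dotZl. Qed.

Lemma dotNr u w : dot w (- u) = - dot w u.
Proof. by rewrite !(dotC w) dotNl. Qed.

Definition dotE := (dotDl, dotDr, dotZl, dotZr, dotNl, dotNr).

Lemma dot_ge0 u : 0 <= dot u u.
Proof. by apply: sumr_ge0 => i _; rewrite -expr2 sqr_ge0. Qed.

Lemma enorm_ge0 u : 0 <= enorm u.
Proof. exact: sqrtr_ge0. Qed.

Lemma enorm_sqr u : enorm u ^+ 2 = dot u u.
Proof. by rewrite sqr_sqrtr ?dot_ge0. Qed.

Lemma enormN u : enorm (- u) = enorm u.
Proof. by rewrite /enorm !dotE opprK. Qed.

Lemma enormZ a u : enorm (a *: u) = `|a| * enorm u.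
Proof.
by rewrite /enorm !dotE mulrA -expr2 sqrtrM ?sqr_ge0// sqrtr_sqr.
Qed.

Lemma enorm0 : enorm (0 : 'cV[R]_n) = 0.
Proof. by rewrite -(scale0r (0 : 'cV[R]_n)) enormZ normr0 mul0r. Qed.

Lemma enorm_coord u i : `|u i ord0| <= enorm u.
Proof.
rewrite -sqrtr_sqr; apply: ler_wsqrtr.
rewrite /dot (bigD1 i)//= -expr2 lerDl.
by apply: sumr_ge0 => j _; rewrite -expr2 sqr_ge0.
Qed.

Lemma dot_sqr_le u v : dot u v ^+ 2 <= dot u u * dot v v.
Proof.
have [v0|v_neq0] := eqVneq (dot v v) 0.
  have -> : v = 0.
    apply/colP => i; rewrite mxE; apply/eqP; rewrite -normr_le0.
    by rewrite (le_trans (enorm_coord v i))// /enorm v0 sqrtr0.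
  by rewrite -(scale0r 0) !dotE !mul0r expr0n mulr0.
(* the residual of the projection of u on the line of v, denominators cleared *)
have := dot_ge0 (dot v v *: u - dot u v *: v).
rewrite !dotE (dotC v u) => H.
have v_gt0 : 0 < dot v v by rewrite lt_def v_neq0 dot_ge0.
rewrite -subr_ge0 -(pmulr_rge0 _ v_gt0); move: H; congr (0 <= _); ring.
Qed.

Lemma dot_le_enorm u v : `|dot u v| <= enorm u * enorm v.
Proof.
rewrite /enorm -sqrtrM ?dot_ge0// -sqrtr_sqr.
by apply: ler_wsqrtr; exact: dot_sqr_le.
Qed.

Lemma enorm_triangle u v : enorm (u + v) <= enorm u + enorm v.
Proof.
rewrite -(ler_pXn2r (n := 2))// ?nnegrE ?addr_ge0 ?enorm_ge0//.
rewrite sqrrD !enorm_sqr !dotE (dotC v u).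
have := le_trans (ler_norm _) (dot_le_enorm u v); lra.
Qed.

Lemma bounded_seq_le {x y : nat -> 'cV[R]_n} {e : nat -> R} :
  bounded_seq x -> (exists B, forall k, e k <= B) ->
  (forall k, enorm (y k - x k) <= e k) -> bounded_seq y.
Proof.
move=> [B xB] [C eC] yx; exists (C + B) => k.
rewrite -(subrK (x k) (y k)) (le_trans (enorm_triangle _ _))// lerD//.
exact: le_trans (yx k) (eC k).
Qed.

End Euclidean.

Lemma dot_trmx_mul {R : realType} {m n : nat} (M : 'M[R]_(m, n))
    (u : 'cV[R]_m) (v : 'cV[R]_n) : dot (M^T *m u) v = dot u (M *m v).
Proof.
rewrite /dot; under eq_bigr do rewrite mxE mulr_suml.
rewrite exchange_big; apply: eq_bigr => i _ /=.
by rewrite mxE mulr_sumr; apply: eq_bigr => j _; rewrite mxE mulrAC mulrC mulrCA mulrA.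
Qed.

Lemma enorm_mulmx_le {R : realType} {m n : nat} (M : 'M[R]_(m, n)) :
  exists2 C, 0 <= C & forall v : 'cV[R]_n, enorm (M *m v) <= C * enorm v.
Proof.
pose S := \sum_(i < m) dot (row i M)^T (row i M)^T.
have S0 : 0 <= S by apply: sumr_ge0 => i _; exact: dot_ge0.
(* the square root of S is the Frobenius norm of M *)
exists (Num.sqrt S) => [|v]; first exact: sqrtr_ge0.
rewrite /enorm -sqrtrM//; apply: ler_wsqrtr.
rewrite mulr_suml; apply: ler_sum => i _; rewrite -expr2.
suff -> : (M *m v) i ord0 = dot (row i M)^T v by exact: dot_sqr_le.
by rewrite mxE; apply: eq_bigr => j _; rewrite !mxE.
Qed.

(** * Limits of vectors and ultrafilters *)

Section Limits.
Context {R : realType} {T : Type} {F : set_system T} {FF : Filter F}.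

Lemma cvg_colP {n : nat} {u : T -> 'cV[R]_n} {l : 'cV[R]_n} :
  u @ F --> l <-> forall i, (fun k => u k i ord0) @ F --> l i ord0.
Proof.
split=> [ul i|ul].
  exact: (continuous_cvg _ (@coord_continuous _ _ _ i ord0 l) ul).
move=> A [P lP PA].
have : \forall k \near F, forall i, P i ord0 (u k i ord0).
  by apply: filter_forall => i; apply: ul; exact: lP.
by apply: filterS => k uP; apply: PA => i j; rewrite (ord1 j); exact: uP.
Qed.

Lemma cvg_mulmx {m n : nat} (M : 'M[R]_(m, n)) {u : T -> 'cV[R]_n} {l} :
  u @ F --> l -> (fun k => M *m u k) @ F --> M *m l.
Proof.
move/cvg_colP => ul; apply/cvg_colP => i; rewrite mxE.
under eq_fun do rewrite mxE.
apply: cvg_big => [|j _]; first exact: add_continuous.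
by apply: cvgM; [exact: cvg_cst|exact: ul].
Qed.

Lemma cvg_dot {n : nat} {u v : T -> 'cV[R]_n} {a b} :
  u @ F --> a -> v @ F --> b -> (fun k => dot (u k) (v k)) @ F --> dot a b.
Proof.
move=> /cvg_colP ua /cvg_colP vb.
apply: cvg_big => [|j _]; first exact: add_continuous.
by apply: cvgM; [exact: ua|exact: vb].
Qed.

Lemma cvg_enorm_distP {n : nat} {u : T -> 'cV[R]_n} {l : 'cV[R]_n} :
  u @ F --> l <-> (fun k => enorm (u k - l)) @ F --> (0 : R).
Proof.
split=> [ul|ul].
  have dl : (fun k => u k - l) @ F --> (0 : 'cV[R]_n).
    by rewrite -(subrr l); apply: cvgB => //; exact: cvg_cst.
  rewrite -(@enorm0 _ n).
  exact: (continuous_cvg FF (@sqrt_continuous R (dot 0 0)) (cvg_dot dl dl)).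
apply/cvg_colP => i; apply/cvgrPdist_le => e e0.
have := ul; move/cvgrPdist_le => /(_ e e0); apply: filterS => k.
rewrite sub0r normrN ger0_norm ?enorm_ge0// => /(le_trans _); apply.
by have := enorm_coord (u k - l) i; rewrite !mxE distrC.
Qed.

Lemma cvg_squeeze0 {a b : T -> R} :
  (forall k, 0 <= a k) -> (forall k, a k <= b k) ->
  b @ F --> (0 : R) -> a @ F --> (0 : R).
Proof.
move=> a0 ab b0; apply: (@squeeze_cvgr _ _ _ _ (fun=> 0) b) => //; last exact: cvg_cst.
by apply: filterE => k; rewrite a0 ab.
Qed.

Lemma cvg_enorm_dist_le {n : nat} {u : T -> 'cV[R]_n} {l : 'cV[R]_n} {b : T -> R} :
  (forall k, enorm (u k - l) <= b k) -> b @ F --> (0 : R) -> u @ F --> l.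
Proof.
move=> ub b0; apply/cvg_enorm_distP; apply: cvg_squeeze0 b0 => // k.
exact: enorm_ge0.
Qed.

Lemma cvg_dot_self0 {n : nat} {u : T -> 'cV[R]_n} :
  (fun k => dot (u k) (u k)) @ F --> (0 : R) -> u @ F --> (0 : 'cV[R]_n).
Proof.
move=> u0; apply/cvg_enorm_distP; under eq_fun do rewrite subr0.
have := continuous_cvg FF (@sqrt_continuous R 0) u0; rewrite sqrtr0; exact.
Qed.

Lemma cvg_finer {X : topologicalType} {G : set_system T} {f : T -> X} {l : X} :
  F `<=` G -> f @ F --> l -> f @ G --> l.
Proof. by move=> FG fl; apply: cvg_trans fl; exact: cvg_app. Qed.

End Limits.

Lemma ultrafilter_fmap {S T : Type} (f : S -> T) {U : set_system S} :
  UltraFilter U -> UltraFilter (f @ U).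
Proof.
move=> UU; split=> [|G GF fUG]; first exact: fmap_proper_filter.
apply/seteqP; split => // A GA.
have [//|UnA] := in_ultra_setVsetC (f @^-1` A) UU.
have GAnA : G (A `&` ~` A) by apply: filterI => //; exact: fUG.
by have /filter_ex[? []] := GAnA.
Qed.

Lemma ultrafilter_cvg_bounded {R : realType} {T : Type} {U : set_system T}
    {n : nat} {u : T -> 'cV[R]_n} {B : R} :
  UltraFilter U -> (forall k, enorm (u k) <= B) ->
  exists l : 'cV[R]_n, u @ U --> l.
Proof.
move=> UU uB.
have lim1 i : exists a : R, (fun k => u k i ord0) @ U --> a.
  have cB := @segment_compact R (- B) B; rewrite compact_ultra in cB.
  have [|a [_ ua]] := cB _ (ultrafilter_fmap (fun k => u k i ord0) UU).
    apply: (@filterE _ U) => k /=; rewrite in_itv/= -ler_norml.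
    exact: le_trans (enorm_coord (u k) i) (uB k).
  by exists a.
have [l ul] := choice lim1.
by exists (\col_i l i); apply/cvg_colP => i; rewrite mxE; exact: ul.
Qed.

(** A filter is the intersection of the ultrafilters that contain it. With
    [ultrafilter_cvg_bounded], this replaces extracting subsequences: to
    identify the limit of a bounded sequence, it is enough to identify its limit
    along each ultrafilter, and all bounded sequences converge along the same
    ultrafilter at once. *)
Lemma cvg_ultrafilter {X : topologicalType} {T : Type} {F : set_system T}
    {FF : ProperFilter F} {f : T -> X} {l : X} :
  (forall U, UltraFilter U -> F `<=` U -> f @ U --> l) -> f @ F --> l.
Proof.
move=> Ul A lA; apply: contrapT => nFA.
have WF : ProperFilter (within (~` (f @^-1` A)) F).
  split=> [W0|].
    apply: nFA; suff : F (f @^-1` A) by [].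
    by move: W0; apply: (@filterS _ F) => k kA; exact: contrapT.
  exact: within_filter.
have [U [UU WU]] := ultraFilterLemma WF.
have FU : F `<=` U by move=> B FB; apply: WU; apply: filterS FB.
have UA : U (f @^-1` A) by exact: Ul UU FU A lA.
have UnA : U (~` (f @^-1` A)) by apply: WU; exact: (@filterE _ F).
have UAnA : U (f @^-1` A `&` ~` (f @^-1` A)) by exact: filterI.
by have [k [Ak nAk]] := filter_ex UAnA; exact: nAk.
Qed.

(** * Subgradients of closed convex functions *)

Section Subgradients.
Context {R : realType} {n : nat} {F : 'cV[R]_n -> \bar R}.
Implicit Types x y z g : 'cV[R]_n.

Lemma proper_lt_pinfty {x} : proper_fun F -> (F x < +oo)%E -> F x \is a fin_num.
Proof. by move=> [Fgt _] Flt; rewrite fin_numElt Fgt Flt. Qed.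

Lemma subdifferential_fin_num {x g} :
  proper_fun F -> subdifferential F x g -> F x \is a fin_num.
Proof.
move=> Fp Fxg; apply: proper_lt_pinfty => //.
have [Fgt [y Fy]] := Fp; have := le_lt_trans (Fxg y) Fy.
by case: (F x) => [r _|/=|_]; rewrite ?ltry// addye.
Qed.

Lemma subdifferential_fine_le {x g} y :
  proper_fun F -> subdifferential F x g -> F y \is a fin_num ->
  fine (F x) + dot g (y - x) <= fine (F y).
Proof.
move=> Fp Fxg Fy; have Fx := subdifferential_fin_num Fp Fxg.
by rewrite -lee_fin EFinD !fineK//; exact: Fxg.
Qed.

Lemma subdifferential_monotone {x g y h} :
  proper_fun F -> subdifferential F x g -> subdifferential F y h ->
  0 <= dot (g - h) (x - y).
Proof.
move=> Fp Fxg Fyh.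
have := subdifferential_fine_le y Fp Fxg (subdifferential_fin_num Fp Fyh).
have := subdifferential_fine_le x Fp Fyh (subdifferential_fin_num Fp Fxg).
rewrite !dotE; lra.
Qed.

Lemma lower_semicontinuous_cvg_le {T : Type} {U : set_system T}
    {UU : ProperFilter U} {x : T -> 'cV[R]_n} {c : T -> R} {xs l} :
  lower_semicontinuous F -> x @ U --> xs -> c @ U --> l ->
  (forall k, (F (x k) <= (c k)%:E)%E) -> (F xs <= l%:E)%E.
Proof.
move=> Flsc xxs cl Fxc; rewrite leNgt; apply/negP => lF.
have [a la aF] : exists2 a : R, l < a & (a%:E < F xs)%E.
  move: lF; case: (F xs) => [r|_|//]; last first.
    by exists (l + 1); rewrite ?ltry// ltrDl.
  by rewrite lte_fin => lr; exists ((l + r) / 2); rewrite ?lte_fin; lra.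
have [V Vxs VF] := Flsc xs a aF.
have Ux : U (x @^-1` V) by exact: xxs.
have Uc : \forall k \near U, c k < a by exact: (cvgr_lt l cl).
have [k [Vk ck]] := filter_ex (filterI Ux Uc).
have := lt_le_trans (VF _ Vk) (Fxc k).
by rewrite lte_fin; move/lt_trans => /(_ _ ck); rewrite ltxx.
Qed.

Lemma subdifferential_closed {T : Type} {U : set_system T}
    {UU : ProperFilter U} {x g : T -> 'cV[R]_n} {xs gs} :
  proper_fun F -> lower_semicontinuous F ->
  x @ U --> xs -> g @ U --> gs ->
  (forall k, subdifferential F (x k) (g k)) -> subdifferential F xs gs.
Proof.
move=> Fp Flsc xxs ggs Fxg y.
have [Fy|] := boolP (F y \is a fin_num); last first.
  by have [Fgt _] := Fp; rewrite fin_numElt Fgt /= -leNgt leye_eq => /eqP ->; rewrite leey.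
have cvgc : (fun k => fine (F y) - dot (g k) (y - x k)) @ U -->
    fine (F y) - dot gs (y - xs).
  apply: cvgB; first exact: cvg_cst.
  by apply: cvg_dot => //; apply: cvgB => //; exact: cvg_cst.
have := lower_semicontinuous_cvg_le Flsc xxs cvgc _.
rewrite EFinB fineK// => H; rewrite -leeBrDr//; apply: H => k.
rewrite -(fineK (subdifferential_fin_num Fp (Fxg k))) lee_fin.
have := subdifferential_fine_le y Fp (Fxg k) Fy; lra.
Qed.

End Subgradients.

Lemma ge0_first_order {R : realType} {a b : R} :
  (forall t, 0 < t -> t < 1 -> 0 <= a + t * b) -> 0 <= a.
Proof.
move=> H; apply/ler_addgt0Pr => e e0.
pose d := 1 + `|b| + e; have d0 : 0 < d by rewrite /d; have := normr_ge0 b; lra.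
have t0 : 0 < e / d by rewrite divr_gt0.
have t1 : e / d < 1 by rewrite ltr_pdivrMr// /d; have := normr_ge0 b; lra.
apply: le_trans (H _ t0 t1) _; rewrite lerD2l mulrAC ler_pdivrMr// ler_pM2l//.
by rewrite /d; have := ler_norm b; lra.
Qed.

Section AugmentedLagrangian.
Context {R : realType} {nx ns : nat} {K : 'cV[R]_nx -> \bar R}.
Context {M : 'M[R]_(ns, nx)} {s : 'cV[R]_ns}.

(** First-order optimality: moving from the minimizer [z] towards [y] by a
    step [t] changes the linear part of the objective at order [t] and the
    penalty by its gradient up to order [t ^+ 2]; convexity of [K] turns the
    resulting inequality at small [t] into a global one. *)
Lemma argmin_augmented_lagrangian {lambda mu z} :
  proper_fun K -> convex_efun K ->
  argmin (augmented_lagrangian K M s lambda mu) z ->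
  subdifferential K z (M^T *m (mu + lambda *: (s - M *m z))).
Proof.
move=> Kp Kc zmin y.
have [Kgt [y0 Ky0]] := Kp.
have ALE w : K w \is a fin_num -> augmented_lagrangian K M s lambda mu w =
    (fine (K w) - dot mu (M *m w)
     + lambda / 2 * enorm (M *m w - s) ^+ 2)%:E.
  by move=> Kw; rewrite /augmented_lagrangian EFinD EFinB fineK.
have Kz : K z \is a fin_num.
  apply: proper_lt_pinfty => //; rewrite ltey; apply/negP => /eqP Kz.
  have := zmin y0; rewrite [leRHS]ALE ?proper_lt_pinfty//.
  by rewrite /augmented_lagrangian Kz.
have [Ky|] := boolP (K y \is a fin_num); last first.
  by rewrite fin_numElt Kgt /= -leNgt leye_eq => /eqP ->; rewrite leey.
rewrite -(fineK Kz) -(fineK Ky) lee_fin dot_trmx_mul -subr_ge0.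
set v := M *m (y - z).
apply: (@ge0_first_order _ _ (lambda / 2 * dot v v)) => t t0 t1.
set w := t *: y + (1 - t) *: z.
have wE : M *m w - s = (M *m z - s) + t *: v.
  rewrite /w /v !mulmxDr -!scalemxAr mulmxN; set a := M *m y; set b := M *m z.
  by apply/colP => i; rewrite !mxE; ring.
have Mw : M *m w = M *m z + t *: v by rewrite -[LHS](subrK s) wE addrAC subrK.
have Kw_le := Kc y z t t0 t1; rewrite -/w in Kw_le.
have Kw : K w \is a fin_num.
  apply: proper_lt_pinfty => //; apply: le_lt_trans Kw_le _.
  by rewrite -(fineK Ky) -(fineK Kz) -!EFinM -EFinD ltry.
rewrite -(fineK Kw) -(fineK Ky) -(fineK Kz) -!EFinM -EFinD lee_fin in Kw_le.
have := zmin w; rewrite !ALE// lee_fin !enorm_sqr wE Mw !dotE.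
rewrite (dotC v (M *m z)) (dotC v s) (dotC (M *m z) s) => H.
rewrite -(pmulr_rge0 _ t0); nra.
Qed.

(** Along the segment from [xhat] to a second feasible minimizer the penalty is
    constant, so strict convexity of the penalized function is strict
    convexity of [K] there: the midpoint would beat the minimum. *)
Lemma saddle_point_unique {xhat muhat w} :
  proper_fun K ->
  strictly_convex_efun
    (fun z : 'cV[R]_nx => (K z + (enorm (M *m z) ^+ 2)%:E)%E) ->
  saddle_point K M s xhat muhat ->
  M *m w = s -> (K w <= K xhat)%E -> w = xhat.
Proof.
move=> Kp [_ Ks] [Kx Mx] Mw Kwx; apply/eqP/negP => /negP wx.
have Kxf := subdifferential_fin_num Kp Kx.
have Kwf : K w \is a fin_num.
  by apply: proper_lt_pinfty => //; rewrite (le_lt_trans Kwx)// -(fineK Kxf) ltry.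
have h0 : (0 : R) < 2^-1 by rewrite invr_gt0.
have h1 : (2^-1 : R) < 1 by lra.
have := Ks w xhat 2^-1 h0 h1 wx.
set m := _ *: w + _.
have Mm : M *m m = s.
  rewrite /m mulmxDr -!scalemxAr Mw Mx -scalerDl.
  by rewrite (_ : _ + _ = 1) ?scale1r//; lra.
rewrite Mm Mw Mx -(fineK Kxf) -(fineK Kwf) -!EFinD !ltry => /(_ isT isT).
set q := enorm s ^+ 2 => H.
have Kmf : K m \is a fin_num.
  apply: proper_lt_pinfty => //; rewrite ltey; apply/negP => /eqP Km.
  by move: H; rewrite Km.
have := subdifferential_fine_le m Kp Kx Kmf.
rewrite dot_trmx_mul mulmxBr Mm Mx subrr -(scale0r (0 : 'cV[R]_ns)) dotZr mul0r.
move: H; rewrite -(fineK Kmf) -EFinD lte_fin.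
by move: Kwx; rewrite -(fineK Kxf) -(fineK Kwf) lee_fin /=; lra.
Qed.

End AugmentedLagrangian.

(** * Sequences that are monotone up to summable errors *)

Lemma cvgn_bounded {R : realType} {u : nat -> R} :
  cvgn u -> exists B, forall k, u k <= B.
Proof.
move=> /cvg_seq_bounded[C [_ uC]]; exists (C + 1) => k.
have := uC (C + 1); rewrite ltrDl ltr01 => /(_ isT k I) /=.
exact: le_trans (ler_norm _).
Qed.

(** Subtracting the partial sums of the errors makes the sequence monotone. *)
Lemma quasi_nonincreasing_is_cvg {R : realType} {u : nat -> R} (e : nat -> R) (B : R) :
  (forall k, B <= u k) -> (forall k, u k.+1 <= u k + e k) ->
  cvgn (series e) -> cvgn u.
Proof.
move=> Bu ue ce.
have [C eC] := cvgn_bounded ce.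
have cv : cvgn (fun k => u k - series e k).
  apply: nonincreasing_is_cvgn.
    apply/nonincreasing_seqP => k; rewrite seriesSr/=; have := ue k; lra.
  exists (B - C) => _ [k _ <-]; have := Bu k; have := eC k; lra.
have -> : u = (fun k => u k - series e k) + series e.
  by apply/funext => k; rewrite fctE subrK.
exact: is_cvgD.
Qed.

(** * The inexact augmented Lagrangian iteration *)

Section InexactAugmentedLagrangian.
Context {R : realType} {nx ns : nat} {K : 'cV[R]_nx -> \bar R}.
Context {M : 'M[R]_(ns, nx)} {s : 'cV[R]_ns} {lambda : R} {nu : nat -> R}.
Context {x z : nat -> 'cV[R]_nx} {mu : nat -> 'cV[R]_ns}.
Hypothesis K_closed_convex : closed_convex K.
Hypothesis lambda_gt0 : 0 < lambda.
Hypothesis nu_summable : cvgn (series nu).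
Hypothesis z_argmin :
  forall k, argmin (augmented_lagrangian K M s lambda (mu k)) (z k).
Hypothesis x_near_z : forall k, enorm (x k.+1 - z k) <= nu k.
Hypothesis mu_step :
  forall k, mu k.+1 = mu k + lambda *: (s - M *m x k.+1).

Let K_proper : proper_fun K. Proof. by have [] := K_closed_convex. Qed.

Definition residual k := M *m z k - s.

(** The next multiplier if the inner minimization were exact. *)
Definition exact_multiplier k := mu k - lambda *: residual k.

Local Notation g := residual.
Local Notation mb := exact_multiplier.

Lemma exact_multiplier_subgradient k :
  subdifferential K (z k) (M^T *m mb k).
Proof.
have [_ Kc _] := K_closed_convex.
have := argmin_augmented_lagrangian K_proper Kc (z_argmin k).
by rewrite /mb /g -scalerN opprB.
Qed.

Lemma multiplier_error : exists e : nat -> R,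
  [/\ forall k, 0 <= e k, cvgn (series e) &
      forall k, enorm (mu k.+1 - mb k) <= e k].
Proof.
have [C C0 MC] := enorm_mulmx_le M.
exists (fun k => lambda * C * nu k); split=> [k||k].
- rewrite mulr_ge0 ?mulr_ge0 ?(ltW lambda_gt0)//.
  exact: le_trans (enorm_ge0 _) (x_near_z k).
- have -> : series (fun k => lambda * C * nu k) = lambda * C *: series nu.
    by apply/funext => k; rewrite /series/= -mulr_sumr.
  exact: is_cvgZr.
have -> : mu k.+1 - mb k = (- lambda) *: (M *m (x k.+1 - z k)).
  rewrite mu_step /mb /g mulmxBr; set a := M *m x _; set b := M *m z _.
  by apply/colP => i; rewrite !mxE; ring.
rewrite enormZ normrN gtr0_norm// -mulrA ler_pM2l//.
by apply: le_trans (MC _) _; rewrite ler_wpM2l.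
Qed.

(** An exact step is a proximal step on the dual problem: monotonicity of the
    subdifferential makes the product of [mb k - muhat] with the step
    [mb k - mu k = - lambda *: g k] nonpositive, and the estimate expands the
    square of their difference. *)
Lemma exact_multiplier_fejer {xhat muhat} k :
  saddle_point K M s xhat muhat ->
  dot (mb k - muhat) (mb k - muhat) + lambda ^+ 2 * dot (g k) (g k) <=
  dot (mu k - muhat) (mu k - muhat).
Proof.
move=> [Kx Mx].
have := subdifferential_monotone K_proper
  (exact_multiplier_subgradient k) Kx.
rewrite -mulmxBr dot_trmx_mul mulmxBr Mx -/(g k) => mono.
have -> : mu k - muhat = (mb k - muhat) + lambda *: g k.
  by rewrite addrAC /mb subrK.
set v := mb k - muhat in mono *.
rewrite !(dotDl v) !(dotDr v) !dotZl !dotZr (dotC (g k)).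
have := mulr_ge0 (ltW lambda_gt0) mono; rewrite expr2; lra.
Qed.

Section WithSaddlePoint.
Context {xhat : 'cV[R]_nx} {muhat : 'cV[R]_ns}.
Hypothesis saddle : saddle_point K M s xhat muhat.

Lemma exact_multiplier_dist_le k : enorm (mb k - muhat) <= enorm (mu k - muhat).
Proof.
apply: ler_wsqrtr; apply: le_trans (exact_multiplier_fejer k saddle).
by rewrite lerDl mulr_ge0 ?sqr_ge0 ?dot_ge0.
Qed.

(** Distances to an optimal multiplier decrease up to the summable error
    between [mu k.+1] and [exact_multiplier k]. *)
Lemma multiplier_dist_is_cvg : cvgn (fun k => enorm (mu k - muhat)).
Proof.
have [e [e0 ce mue]] := multiplier_error.
apply: (quasi_nonincreasing_is_cvg e 0) => // k; first exact: enorm_ge0.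
have -> : mu k.+1 - muhat = (mb k - muhat) + (mu k.+1 - mb k).
  by rewrite [RHS]addrC addrA subrK.
apply: le_trans (enorm_triangle _ _) _.
by rewrite lerD ?exact_multiplier_dist_le.
Qed.

Lemma exact_multiplier_bounded : bounded_seq mb.
Proof.
apply: (@bounded_seq_le _ _ (fun=> muhat) _ (fun k => enorm (mu k - muhat))).
- by exists (enorm muhat).
- exact: cvgn_bounded multiplier_dist_is_cvg.
- exact: exact_multiplier_dist_le.
Qed.

(** The distances of [mu k] and of [mb k] to [muhat] have the same limit, and
    the gap between their squares dominates the squared residual. *)
Lemma residual_cvg0_saddle : g @ \oo --> (0 : 'cV[R]_ns).
Proof.
have [e [e0 ce mue]] := multiplier_error.
have /cvg_ex[a mua] := multiplier_dist_is_cvg.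
have mba : (fun k => enorm (mb k - muhat)) @ \oo --> a.
  have mua1 : (fun k => enorm (mu k.+1 - muhat)) @ \oo --> a.
    by rewrite (cvg_shiftS (fun k => enorm (mu k - muhat))).
  apply: (@squeeze_cvgr _ _ _ _ (fun k => enorm (mu k.+1 - muhat) - e k)
    (fun k => enorm (mu k - muhat))) => //.
    apply: filterE => k; rewrite exact_multiplier_dist_le andbT lerBlDr.
    have -> : mu k.+1 - muhat = (mb k - muhat) + (mu k.+1 - mb k).
      by rewrite [RHS]addrC addrA subrK.
    by apply: le_trans (enorm_triangle _ _) _; rewrite lerD2l.
  by rewrite -[a]subr0; apply: cvgB => //; exact: cvg_series_cvg_0.
apply: cvg_dot_self0.
have c0 : (fun k => lambda ^- 2 *
    (enorm (mu k - muhat) ^+ 2 - enorm (mb k - muhat) ^+ 2)) @ \oo --> (0 : R).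
  rewrite -[X in _ --> X](mulr0 (lambda ^- 2)) -(subrr (a ^+ 2)).
  apply: cvgM; first exact: cvg_cst.
  by apply: cvgB; apply: cvgM.
apply: cvg_squeeze0 c0 => k; first exact: dot_ge0.
rewrite mulrC ler_pdivlMr ?exprn_gt0// !enorm_sqr.
have := exact_multiplier_fejer k saddle; lra.
Qed.

(** The value of [K] at [z k] exceeds that at [xhat] by at most
    [dot (mb k) (g k)], which vanishes in the limit. Points [w k] of the
    segments from [xhat] to [z k], kept within distance one of [xhat], inherit
    this bound by convexity; every limit of the [w k] is thus a feasible
    minimizer, hence [xhat] by strict convexity, and the distance of [z k] is a
    continuous function of that of [w k]. *)
Lemma exact_minimizer_cvg :
  strictly_convex_efun
    (fun z : 'cV[R]_nx => (K z + (enorm (M *m z) ^+ 2)%:E)%E) ->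
  z @ \oo --> xhat.
Proof.
move=> K_strict; have [Kx Mx] := saddle.
have [_ Kc Klsc] := K_closed_convex.
have Kxf := subdifferential_fin_num K_proper Kx.
have Kzf k := subdifferential_fin_num K_proper (exact_multiplier_subgradient k).
have g0 : (fun k => enorm (g k)) @ \oo --> (0 : R).
  by have /cvg_enorm_distP := residual_cvg0_saddle; under eq_fun do rewrite subr0.
have [B mbB] := exact_multiplier_bounded.
pose c k := fine (K xhat) + B * enorm (g k).
have cK : c @ \oo --> fine (K xhat).
  rewrite -[X in _ --> X]addr0 -(mulr0 B).
  by apply: cvgD; [exact: cvg_cst|apply: cvgM => //; exact: cvg_cst].
have Kz k : fine (K (z k)) <= c k.
  have := subdifferential_fine_le xhat K_proper
    (exact_multiplier_subgradient k) Kxf.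
  rewrite dot_trmx_mul mulmxBr Mx -opprB dotNr -/(g k) /c.
  have := le_trans (ler_norm _) (dot_le_enorm (mb k) (g k)).
  have := ler_wpM2r (enorm_ge0 (g k)) (mbB k); lra.
pose r k := enorm (z k - xhat); pose t k := (2 + r k)^-1.
have r0 k : 0 <= r k by exact: enorm_ge0.
have t0 k : 0 < t k by rewrite invr_gt0 ltr_pwDl.
have t1 k : t k < 1 by have := r0 k => r0k; rewrite invf_lt1; lra.
pose w k := t k *: z k + (1 - t k) *: xhat.
have wx k : enorm (w k - xhat) = t k * r k.
  have -> : w k - xhat = t k *: (z k - xhat).
    by rewrite /w; apply/colP => i; rewrite !mxE; ring.
  by rewrite enormZ gtr0_norm.
have wx1 k : enorm (w k - xhat) <= 1.
  by rewrite wx /t mulrC ler_pdivrMr ?ltr_pwDl//; have := r0 k; lra.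
have [Bw wB] : bounded_seq w.
  apply: (@bounded_seq_le _ _ (fun=> xhat) _ (fun=> 1)) => //.
    by exists (enorm xhat).
  by exists 1.
have Kw k : (K (w k) <= (c k)%:E)%E.
  apply: le_trans (Kc (z k) xhat (t k) (t0 k) (t1 k)) _.
  rewrite -(fineK Kxf) -(fineK (Kzf k)) -!EFinM -EFinD lee_fin.
  have xc : fine (K xhat) <= c k.
    rewrite /c lerDl mulr_ge0 ?enorm_ge0//.
    exact: le_trans (enorm_ge0 _) (mbB k).
  have t1' : 0 <= 1 - t k by rewrite subr_ge0 ltW.
  have := ler_wpM2l (ltW (t0 k)) (Kz k); have := ler_wpM2l t1' xc; lra.
have Mw : (fun k => M *m w k) @ \oo --> s.
  apply: cvg_enorm_dist_le g0 => k.
  have -> : M *m w k - s = t k *: g k.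
    rewrite /w /g mulmxDr -!scalemxAr Mx.
    by set a := M *m z k; apply/colP => i; rewrite !mxE; ring.
  by rewrite enormZ gtr0_norm// ler_piMl ?enorm_ge0// ltW.
have wxhat : w @ \oo --> xhat.
  apply: cvg_ultrafilter => U UU FU.
  have [ws wws] := ultrafilter_cvg_bounded UU wB.
  suff <- : ws = xhat by [].
  apply: (saddle_point_unique K_proper K_strict saddle).
    apply: (cvg_unique _ (cvg_mulmx M wws) (cvg_finer FU Mw)).
    exact: norm_hausdorff.
  rewrite -(fineK Kxf).
  exact: (lower_semicontinuous_cvg_le Klsc wws (cvg_finer FU cK) Kw).
apply/cvg_enorm_distP.
pose q k := enorm (w k - xhat).
have q0 : q @ \oo --> (0 : R) by apply/cvg_enorm_distP.
(* q = r / (2 + r) is inverted to r = 2 q / (1 - q) *)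
have rq k : r k = 2 * q k / (1 - q k).
  rewrite /q wx /t; have := r0 k => r0k.
  have d0 : 2 + r k != 0 by rewrite gt_eqF// ltr_pwDl.
  have -> : 1 - (2 + r k)^-1 * r k = 2 / (2 + r k) by field.
  by field.
rewrite -[X in _ @ _ --> X](_ : 2 * 0 / (1 - 0) = 0 :> R); last by rewrite mulr0 mul0r.
under eq_fun do rewrite -/(r _) rq.
apply: cvgM.
  by apply: cvgM => //; exact: cvg_cst.
apply: cvgV; first by rewrite subr0 oner_neq0.
by apply: cvgB => //; exact: cvg_cst.
Qed.

End WithSaddlePoint.

(** With no optimal multiplier to measure distances from, the dual objective
    takes their place. Its value at [mb k] is
    [- u k = K (z k) - dot (mb k) (g k)]. Each step increases it by [lambda]
    times the squared residual, up to a summable error since the residuals are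
    bounded, and it is bounded above by weak duality against a point [y] of the
    domain of [K], since the multipliers are bounded. *)
Lemma residual_cvg0_bounded :
  bounded_seq z -> bounded_seq mb -> g @ \oo --> (0 : 'cV[R]_ns).
Proof.
move=> [Bz zB] [Bm mB].
have [e [e0 ce mue]] := multiplier_error.
have Kzf k := subdifferential_fin_num K_proper (exact_multiplier_subgradient k).
have [C C0 MC] := enorm_mulmx_le M.
pose B := C * Bz + enorm s.
have gB k : enorm (g k) <= B.
  rewrite /g; apply: le_trans (enorm_triangle _ _) _; rewrite enormN lerD2r.
  by apply: le_trans (MC _) _; rewrite ler_wpM2l.
pose u k := dot (mb k) (g k) - fine (K (z k)).
have uS k : u k.+1 <= u k + (B * e k - lambda * dot (g k.+1) (g k.+1)).
  have := subdifferential_fine_le (z k.+1) K_proper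
    (exact_multiplier_subgradient k) (Kzf k.+1).
  have -> : dot (M^T *m mb k) (z k.+1 - z k) = dot (mb k) (g k.+1) - dot (mb k) (g k).
    rewrite dot_trmx_mul -dotNr -dotDr; congr (dot _ _).
    by rewrite mulmxBr /g opprB addrA subrK.
  have mbS : mb k.+1 = mb k + (mu k.+1 - mb k) - lambda *: g k.+1.
    by rewrite [mb k + _]addrC subrK.
  rewrite /u [mb k.+1]mbS (dotDl (mb k + _)) (dotDl (mb k)) dotNl dotZl.
  have := le_trans (ler_norm _) (dot_le_enorm (mu k.+1 - mb k) (g k.+1)).
  have : enorm (mu k.+1 - mb k) * enorm (g k.+1) <= B * e k.
    by rewrite mulrC ler_pM ?enorm_ge0.
  lra.
have [L uL] : exists L, forall k, L <= u k.
  have [_ [y Ky]] := K_proper.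
  have Kyf : K y \is a fin_num by exact: proper_lt_pinfty.
  exists (- (Bm * enorm (M *m y - s)) - fine (K y)) => k.
  have := subdifferential_fine_le y K_proper (exact_multiplier_subgradient k) Kyf.
  have -> : dot (M^T *m mb k) (y - z k) = dot (mb k) (M *m y - s) - dot (mb k) (g k).
    rewrite dot_trmx_mul -dotNr -dotDr; congr (dot _ _).
    by rewrite mulmxBr /g opprB addrA subrK.
  have := ler_norm (- dot (mb k) (M *m y - s)); rewrite normrN.
  move=> /le_trans /(_ (dot_le_enorm _ _)).
  have := ler_wpM2r (enorm_ge0 (M *m y - s)) (mB k).
  rewrite /u; lra.
have cBe : cvgn (series (fun k => B * e k)).
  have -> : series (fun k => B * e k) = B *: series e.
    by apply/funext => k; rewrite /series/= -mulr_sumr.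
  exact: is_cvgZr.
have /cvg_ex[l ul] : cvgn u.
  apply: (quasi_nonincreasing_is_cvg (fun k => B * e k) L) => // k.
  have := uS k; have := mulr_ge0 (ltW lambda_gt0) (dot_ge0 (g k.+1)); lra.
have ul1 : (fun k => u k.+1) @ \oo --> l by rewrite (cvg_shiftS u).
have c0 : (fun k => lambda^-1 * (u k - u k.+1 + B * e k)) @ \oo --> (0 : R).
  rewrite -[X in _ @ _ --> X](mulr0 lambda^-1) -[X in _ * X](addr0 0) -{1}(subrr l).
  apply: cvgM; first exact: cvg_cst.
  by apply: cvgD; [exact: cvgB|exact: cvg_series_cvg_0].
rewrite -(cvg_shiftS g).
apply: cvg_dot_self0; apply: cvg_squeeze0 c0 => k; first exact: dot_ge0.
rewrite mulrC ler_pdivlMr//; have := uS k; lra.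
Qed.

(** The graph of the subdifferential is closed, and vanishing residuals make
    every limit of the [z k] feasible. *)
Lemma limit_saddle_point {U : set_system nat} {UU : ProperFilter U} {zs ms} :
  \oo `<=` U -> g @ \oo --> (0 : 'cV[R]_ns) ->
  z @ U --> zs -> mb @ U --> ms -> saddle_point K M s zs ms.
Proof.
move=> FU g0 zzs mbms; have [_ _ Klsc] := K_closed_convex; split.
  exact: (subdifferential_closed K_proper Klsc zzs (cvg_mulmx M^T mbms)
    exact_multiplier_subgradient).
apply/eqP; rewrite -subr_eq0; apply/eqP.
apply: (cvg_unique _ _ (cvg_finer FU g0)); first exact: norm_hausdorff.
by apply: cvgB; [exact: cvg_mulmx|exact: cvg_cst].
Qed.

(** A limit [ms] of the bounded multipliers along one ultrafilter is optimal, so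
    the distance of [mu k] to [ms] has a limit along the integers; that limit is
    zero because it is so along the ultrafilter. *)
Lemma multiplier_cvg {xhat muhat} :
  saddle_point K M s xhat muhat -> z @ \oo --> xhat ->
  exists2 mustar, saddle_point K M s xhat mustar & mu @ \oo --> mustar.
Proof.
move=> saddle zx.
have g0 := residual_cvg0_saddle saddle.
have [B mbB] := exact_multiplier_bounded saddle.
have [U [UU FU]] := ultraFilterLemma eventually_filter.
have [ms mbms] := ultrafilter_cvg_bounded UU mbB.
have sad : saddle_point K M s xhat ms.
  exact: (limit_saddle_point FU g0 (cvg_finer FU zx) mbms).
exists ms => //.
have mums : mu @ U --> ms.
  have -> : mu = (fun k => mb k + lambda *: g k).
    by apply/funext => k; rewrite /mb subrK.
  rewrite -[X in _ --> X]addr0 -(scaler0 _ lambda).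
  by apply: cvgD => //; apply: cvgZr; exact: cvg_finer g0.
have /cvg_ex[a mua] := multiplier_dist_is_cvg sad.
apply/cvg_enorm_distP; suff <- : a = 0 by [].
apply: (cvg_unique _ (cvg_finer FU mua)); first exact: norm_hausdorff.
by apply/cvg_enorm_distP.
Qed.

Lemma bounded_saddle_point : bounded_seq x -> bounded_seq mu ->
  exists xhat muhat, saddle_point K M s xhat muhat.
Proof.
move=> [Bx xB] [Bm mB].
have [e [e0 ce mue]] := multiplier_error.
have zb : bounded_seq z.
  apply: (@bounded_seq_le _ _ (fun k => x k.+1) _ nu).
  - by exists Bx.
  - by apply: cvgn_bounded; apply: cvgP; exact: cvg_series_cvg_0.
  - by move=> k; rewrite -opprB enormN.
have mbb : bounded_seq mb.
  apply: (@bounded_seq_le _ _ (fun k => mu k.+1) _ e).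
  - by exists Bm.
  - by apply: cvgn_bounded; apply: cvgP; exact: cvg_series_cvg_0.
  - by move=> k; rewrite -opprB enormN.
have g0 := residual_cvg0_bounded zb mbb.
have [[Bz zB] [Bmb mbB]] := (zb, mbb).
have [U [UU FU]] := ultraFilterLemma eventually_filter.
have [zs zzs] := ultrafilter_cvg_bounded UU zB.
have [ms mbms] := ultrafilter_cvg_bounded UU mbB.
by exists zs, ms; exact: (limit_saddle_point FU g0 zzs mbms).
Qed.

End InexactAugmentedLagrangian.

Theorem theorem3p1 (R : realType) (nx ns : nat)
    (K : 'cV[R]_nx -> \bar R) (M : 'M[R]_(ns, nx)) (s : 'cV[R]_ns)
    (lambda : R) (nu : nat -> R)
    (x : nat -> 'cV[R]_nx) (mu : nat -> 'cV[R]_ns)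
    (K_closed_convex : closed_convex K)
    (K_strict : strictly_convex_efun
       (fun z : 'cV[R]_nx => (K z + (enorm (M *m z) ^+ 2)%:E)%E))
    (lambda_gt0 : 0 < lambda)
    (nu_ge0 : forall k, 0 <= nu k)
    (nu_summable : (\sum_(0 <= k <oo) (nu k)%:E < +oo)%E)
    (x_step : forall k,
       exists2 z, argmin (augmented_lagrangian K M s lambda (mu k)) z
                & enorm (x k.+1 - z) < nu k)
    (mu_step : forall k, mu k.+1 = mu k + lambda *: (s - M *m x k.+1)) :
  (forall (xhat : 'cV[R]_nx) (muhat : 'cV[R]_ns),
     saddle_point K M s xhat muhat ->
     x @ \oo --> xhat /\
     exists2 mustar, saddle_point K M s xhat mustar & mu @ \oo --> mustar) /\
  (~ (exists (xhat : 'cV[R]_nx) (muhat : 'cV[R]_ns),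
        saddle_point K M s xhat muhat) ->
   ~ bounded_seq x \/ ~ bounded_seq mu).
Proof.
have nu_cvg := nnseries_is_cvg nu_ge0 nu_summable.
have /choice[z zP] : forall k, exists z,
    argmin (augmented_lagrangian K M s lambda (mu k)) z /\
    enorm (x k.+1 - z) <= nu k.
  by move=> k; have [z zmin /ltW] := x_step k; exists z.
have zmin k := (zP k).1; have xz k := (zP k).2.
split=> [xhat muhat saddle|no_saddle].
  have zx := exact_minimizer_cvg K_closed_convex lambda_gt0 nu_cvg zmin xz mu_step
    saddle K_strict.
  split; last exact: (multiplier_cvg K_closed_convex lambda_gt0 nu_cvg zmin xz
    mu_step saddle zx).
  rewrite -(cvg_shiftS x).
  have d0 : (fun k => nu k + enorm (z k - xhat)) @ \oo --> (0 : R).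
    rewrite -[X in _ @ _ --> X]addr0; apply: cvgD; first exact: cvg_series_cvg_0.
    by apply/cvg_enorm_distP.
  apply: cvg_enorm_dist_le d0 => k /=.
  rewrite -(subrK (z k) (x k.+1)) -addrA.
  by apply: le_trans (enorm_triangle _ _) _; rewrite lerD2r.
apply/not_andP => -[xb mub]; apply: no_saddle.
exact: (bounded_saddle_point K_closed_convex lambda_gt0 nu_cvg zmin xz mu_step xb mub).
Qed.
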